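(* Let $\mathcal H=\{\mathfrak H_i : i\ge 1\}$ be the family of plane graphs defined in the context, where $\mathfrak H_i$ has $3i+4$ vertices. Every $n$-vertex plane graph in $\mathcal H$ admits a planar angle-monotone drawing on an $O(n)\times O(n)$ grid that respects its plane embedding. That is, there is an absolute constant $C$ such that every $n$-vertex plane graph $\mathfrak H\in\mathcal H$ has a planar straight-line drawing that is angle-monotone, realizes the given plane embedding (including the outer face) of $\mathfrak H$, and lies on a $W\times H$ grid with $W,H\le Cn$.
   Context: **Drawings.** A straight-line drawing of a graph maps each vertex to a point of $\mathbb R^2$ and each edge to the straight-line segment between its end-points. It is planar if no two edges cross. Two planar drawings of a connected planar graph are equivalent if they determine the same circular order of edges around each vertex; a planar embedding is an equivalence class, and a plane graph is a planar graph with a planar embedding and a designated outer face. A grid drawing maps each vertex to a point with integer coordinates; its width (resp. height) is the number of grid columns (resp. rows) intersecting it. A drawing lies on a $W\times H$ grid if it is a grid drawing with width $W$ and height $H$. **Angle-monotone drawings.** The slope of an edge traversed from $u$ to $v$ is the angle in $[0,2\pi)$ by which a rightward ray from $u$ must be rotated counter-clockwise to overlap with the segment from $u$ to $v$. A path $(w_1,\dots,w_k)$ in a straight-line drawing is $\beta$-monotone if, for each $i=1,\dots,k-1$, the edge $(w_i,w_{i+1})$ lies in the closed wedge of angle $\pi/2$ with apex $w_i$ bisected by the ray from $w_i$ with slope $\beta$ (i.e. its slope from $w_i$ to $w_{i+1}$ lies in $[\beta-\frac{\pi}{4},\beta+\frac{\pi}{4}]$ modulo $2\pi$). A straight-line drawing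 is angle-monotone if for every pair of vertices $u,v$ there is, for some angle $\beta$, a $\beta$-monotone path from $u$ to $v$ in the graph. **The family $\mathcal H$.** The plane graph $\mathfrak H_1$ consists of a cycle $(x_2,z_1,y_2,x_1,z_2,y_1)$, which bounds the outer face, and of a vertex $x_0$ embedded inside this cycle and adjacent to $x_1,y_1,z_1$. For $i\ge 2$, $\mathfrak H_i$ is obtained from $\mathfrak H_{i-1}$ by embedding in the outer face of $\mathfrak H_{i-1}$ three new vertices $x_{i+1},y_{i+1},z_{i+1}$ and the edges of the cycle $(x_{i+1},z_i,y_{i+1},x_i,z_{i+1},y_i)$, which bounds the outer face of $\mathfrak H_i$. *)

(* Defs.v *)
From HB Require Import structures.
From mathcomp Require Import all_boot all_order all_algebra.
From mathcomp Require Import finmap.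
From mathcomp Require Import all_classical all_reals all_analysis.
From mathcomp Require Import zify.

Set Implicit Arguments.
Unset Strict Implicit.
Unset Printing Implicit Defensive.

Import Order.TTheory GRing.Theory Num.Theory.
Import numFieldNormedType.Exports.

Local Open Scope classical_set_scope.
Local Open Scope card_scope.
Local Open Scope ring_scope.

(* [nbrs v] lists the neighbours of [v] in counterclockwise circular order, up
   to rotation of the list.  [outer] is the closed walk bounding the outer
   face. *)
Record plane_graph (T : choiceType) := PlaneGraph {
  vertices : {fset T};
  nbrs : T -> seq T;
  outer : seq T }.

Definition adj (T : choiceType) (G : plane_graph T) : rel T :=
  [rel u v | v \in nbrs G u].

Definition mirror (T : choiceType) (G : plane_graph T) : plane_graph T :=
  PlaneGraph (vertices G) (fun v => rev (nbrs G v)) (rev (outer G)).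

(* Embeds in the outer face of G the vertices of C not in G and the edges of
   the cycle C, listed counterclockwise, which bounds the new outer face.  At
   a vertex of C, the old edges lie counterclockwise after the edge to the
   successor and before the edge to the predecessor.  This assumes that
   [nbrs G v], for a vertex [v] of C in G, is listed from the outer face of G
   on; then so is the new list, for the new outer face. *)
Definition wrap (T : choiceType) (C : seq T) (G : plane_graph T) :
    plane_graph T :=
  PlaneGraph ([fset v in C] `|` vertices G)%fset
    (fun v => if v \in C then next C v :: rcons (nbrs G v) (prev C v)
              else nbrs G v)
    C.

Definition hx (i : nat) : nat * nat := (0, i)%N.
Definition hy (i : nat) : nat * nat := (1, i)%N.
Definition hz (i : nat) : nat * nat := (2, i)%N.

Definition hstar : plane_graph (nat * nat)%type :=
  PlaneGraph [fset hx 0; hx 1; hy 1; hz 1]%fset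
    (fun v => if v == hx 0 then [:: hx 1; hy 1; hz 1]
              else if v \in [:: hx 1; hy 1; hz 1] then [:: hx 0] else [::])
    [:: hx 0; hx 1; hx 0; hy 1; hx 0; hz 1].

Definition hcycle (i : nat) : seq (nat * nat) :=
  [:: hx i.+1; hz i; hy i.+1; hx i; hz i.+1; hy i].

(* [frakH 0] only serves as the seed of the recursion: the graph
   [frakH 1 = wrap (hcycle 1) hstar] is the hexagon [hcycle 1] with [hx 0]
   inside, adjacent to [hx 1], [hy 1] and [hz 1]. *)
Fixpoint frakH (i : nat) : plane_graph (nat * nat)%type :=
  if i is j.+1 then wrap (hcycle i) (frakH j) else hstar.

(* Saying that each hexagon bounds the outer face determines the embedding only
   up to a reflection of the plane; both embeddings are in the family. *)
Definition familyH (G : plane_graph (nat * nat)%type) : Prop :=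
  exists2 i : nat, (1 <= i)%N & G = frakH i \/ G = mirror (frakH i).

Lemma card_fset_uniq (T : choiceType) (s : seq T) (A : {fset T}) :
  uniq s -> A =i s -> #|` A|%fset = size s.
Proof. by move=> us As; apply/perm_size/uniq_perm. Qed.

Lemma card_frakH (i : nat) : #|` vertices (frakH i)|%fset = (3 * i + 4)%N.
Proof.
have mem_frakH j v : (v \in vertices (frakH j)) =
    (v == hx 0) || [&& v.1 < 3, 0 < v.2 & v.2 <= j.+1]%N.
  case: v => c k; elim: j => [|j IHj] /=.
    rewrite !inE /hx /hy /hz !xpair_eqE.
    by case: c => [|[|[|c]]]; case: k => [|[|k]].
  rewrite !inE {}IHj /hx /hy /hz !xpair_eqE /=.
  by case: c => [|[|[|c]]] //=; lia.
pose s := [seq (c, k) | c <- iota 0 3, k <- iota 1 i.+1].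
rewrite (@card_fset_uniq _ (hx 0 :: s)).
- rewrite -[size _]/(size s).+1 size_allpairs !size_iota; lia.
- rewrite cons_uniq allpairs_uniq ?iota_uniq // => [|[a b] [c d] _ _ //].
  rewrite andbT; apply/negP => /allpairsP[[c k]] [_].
  by rewrite mem_iota => + [_ k0]; rewrite -k0.
- move=> [c k]; apply/idP/idP.
    rewrite mem_frakH in_cons => /orP[->//|/and3P[/= c3 k0 ki]].
    by apply/orP; right; apply/allpairsP; exists (c, k); split; rewrite ?mem_iota //=; lia.
  rewrite mem_frakH in_cons => /orP[->//|/allpairsP[[c' k']]] [].
  by rewrite !mem_iota /= => c3 ki [-> ->]; apply/orP; right; apply/and3P; split; lia.
Qed.

Section Drawings.
Variables (R : realType) (T : choiceType) (G : plane_graph T).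

Definition segment (p q : R * R) : set (R * R) :=
  [set a | exists2 t : R, 0 <= t <= 1 &
    a = ((1 - t) * p.1 + t * q.1, (1 - t) * p.2 + t * q.2)].

Definition slope (p q : R * R) : R :=
  xget 0 [set th : R | 0 <= th < 2 * pi /\
    exists2 r : R, 0 < r & q.1 - p.1 = r * cos th /\ q.2 - p.2 = r * sin th].

(* A straight-line drawing; only its values on [vertices G] matter. *)
Variable D : T -> R * R.

Definition drawing_points : set (R * R) :=
  [set p | (exists2 v, v \in vertices G & p = D v) \/
           (exists u v, adj G u v /\ segment (D u) (D v) p)].

Definition planar_drawing : Prop :=
  [/\ {in vertices G &, injective D},
      forall u v w, adj G u v -> w \in vertices G ->
        segment (D u) (D v) (D w) -> w \in [:: u; v]
    & forall u v u' v', adj G u v -> adj G u' v' ->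
        ~~ perm_eq [:: u; v] [:: u'; v'] ->
        forall p, segment (D u) (D v) p -> segment (D u') (D v') p ->
        exists w, [/\ w \in [:: u; v], w \in [:: u'; v'] & p = D w]].

Definition in_wedge (beta : R) (p q : R * R) : Prop :=
  exists k : int,
    beta - pi / 4 <= slope p q + k%:~R * (2 * pi) <= beta + pi / 4.

Definition angle_monotone : Prop :=
  forall u v, u \in vertices G -> v \in vertices G ->
  exists (beta : R) (w : seq T),
    [/\ path (adj G) u w, uniq (u :: w), last u w = v
      & path (fun a b => `[< in_wedge beta (D a) (D b) >]) u w].

(* Slopes increase counterclockwise. *)
Definition same_circular_orders : Prop :=
  forall v, v \in vertices G -> exists k : nat,
    sorted <%R [seq slope (D v) (D u) | u <- rot k (nbrs G v)].

Definition outer_face : set (R * R) :=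
  [set p | ~ drawing_points p /\
           ~ bounded_set (connected_component (~` drawing_points) p)].

Definition same_outer_face : Prop :=
  closure outer_face `\` outer_face° =
  [set p | exists2 u, u \in outer G &
             segment (D u) (D (next (outer G) u)) p].

Definition respects_embedding : Prop :=
  same_circular_orders /\ same_outer_face.

Definition grid_drawing : Prop :=
  forall v, v \in vertices G ->
    (D v).1 \is a Num.int /\ (D v).2 \is a Num.int.

Definition lies_on_grid (W H : nat) : Prop :=
  [/\ grid_drawing,
      [set c : int | exists2 p, drawing_points p & p.1 = c%:~R] #= `I_W
    & [set c : int | exists2 p, drawing_points p & p.2 = c%:~R] #= `I_H].

End Drawings.

(* Main.v *)
Require Import Defs.
From mathcomp Require Import all_boot all_order all_algebra.
From mathcomp Require Import finmap.
From mathcomp Require Import all_classical all_reals all_analysis.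
From mathcomp Require Import zify ring lra.

(* Call the vertices x_k, y_k, z_k, and x_0 when k = 0, the vertices of level k.
   Every edge joins two consecutive levels, and the three paths that start at
   x_0 and continue with x_1, z_2, x_3, z_4 etc., with y_1, x_2, y_3, x_4 etc.,
   and with z_1, y_2, z_3, y_4 etc., use all the vertices.  Draw them straight, on the rays from the origin directed
   by (1, 0), (0, 1) and (-1, -1), with the vertex of level k at k times the
   direction of its ray.
   - Any two of the rays make an angle of at least 90 degrees, so that going
     from u to the origin along a ray and then from the origin to v along
     another ray turns by at most 90 degrees: the path is angle-monotone.
   - The function [level], linear on each of the three sectors between the
     rays, increases at unit speed along each edge from one level to the next;
     so two edges can only meet between the same two levels, at the same time,
     and then they are equal or meet at a common end.
   - The outer hexagon bounds a pinwheel P, the union of three triangles with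
     apex the origin.  P is closed and star-shaped, so the complement of P is in
     the outer face; P minus the hexagon is open and bounded, so it is not. *)

Set Implicit Arguments.
Unset Strict Implicit.
Unset Printing Implicit Defensive.

Import Order.TTheory GRing.Theory Num.Theory.
Import numFieldNormedType.Exports.

Local Open Scope classical_set_scope.
Local Open Scope card_scope.
Local Open Scope ring_scope.

(** * Vertices, neighbours and edges of [frakH i] in closed form *)

Definition in_frakH (i : nat) (v : nat * nat) : bool :=
  (v == hx 0) || [&& v.1 < 3, 0 < v.2 & v.2 <= i.+1]%N.

Lemma mem_frakH (i : nat) (v : nat * nat) :
  (v \in vertices (frakH i)) = in_frakH i v.
Proof.
rewrite /in_frakH; case: v => c k; elim: i => [|i IHi] /=.
  rewrite !inE /hx /hy /hz !xpair_eqE.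
  by case: c => [|[|[|c]]]; case: k => [|[|k]].
rewrite !inE {}IHi /hx /hy /hz !xpair_eqE /=.
by case: c => [|[|[|c]]] //=; lia.
Qed.

(** A vertex of level k >= 1 lies only on the hexagons of indices k - 1 and k. The first gives
    [inner], replaced by x_0 at level 1; the second gives the edges to level k + 1, absent at the
    top level i + 1. [cw] and [ccw] are the letters of its successor and predecessor on a
    hexagon. *)
Definition frakH_nbrs (i : nat) (v : nat * nat) : seq (nat * nat) :=
  if v == hx 0 then [:: hx 1; hy 1; hz 1]
  else if in_frakH i v then
    let cw := ((v.1 + 2) %% 3)%N in let ccw := ((v.1 + 1) %% 3)%N in
    let inner := if v.2 == 1%N then [:: hx 0] else [:: (cw, v.2.-1); (ccw, v.2.-1)] in
    if (v.2 <= i)%N then (cw, v.2.+1) :: rcons inner (ccw, v.2.+1) else inner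
  else [::].

Lemma nbrs_frakH (i : nat) (v : nat * nat) : nbrs (frakH i) v = frakH_nbrs i v.
Proof.
elim: i v => [|i IHi] [c k] /=.
  rewrite /frakH_nbrs /in_frakH !inE /hx /hy /hz !xpair_eqE.
  by case: c => [|[|[|c]]]; case: k => [|[|k]].
case: ifP => kC.
  move: kC; rewrite !inE IHi /frakH_nbrs /in_frakH /next /prev /= /hx /hy /hz.
  have n1 : (i.+2 == i.+1) = false by lia.
  have n2 : (i.+1 == i.+2) = false by lia.
  have n3 : (i.+2 <= i.+1)%N = false by lia.
  have n4 : (i.+1 <= i)%N = false by lia.
  have n5 : (i.+2 <= i)%N = false by lia.
  have n6 : (i.+1 <= i.+2)%N by lia.
  by case/or4P => [|||/or3P[]] => /eqP[-> ->]; rewrite !xpair_eqE /= ?ltnn ?leqnn ?eqxx ?n1 ?n2 ?n3 ?n4 ?n5 ?n6.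
rewrite IHi /frakH_nbrs /in_frakH; move: kC.
rewrite !inE /hx /hy /hz !xpair_eqE /= => kC.
case: ifP => // k0; rewrite k0 /=; case: ltnP => //= c3.
have -> : (k <= i.+2)%N = (k <= i.+1)%N by case: c kC k0 c3 => [|[|[|c]]]; lia.
by have -> : (k <= i.+1)%N = (k <= i)%N by case: c kC k0 c3 => [|[|[|c]]]; lia.
Qed.

(** A hexagon is the complete bipartite graph between two consecutive levels minus the pairs of
    equal letters. Level 0 is the exception: x_0 is joined to x_1 as well. *)
Definition up (u v : nat * nat) : bool :=
  (v.2 == u.2.+1) && ((u.2 == 0%N) || (u.1 != v.1)).

Lemma adj_frakH (i : nat) (u v : nat * nat) : adj (frakH i) u v =
  [&& in_frakH i u, in_frakH i v & up u v || up v u].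
Proof.
rewrite /adj /= nbrs_frakH /frakH_nbrs /in_frakH /up.
case: u v => [c k] [d l]; rewrite /hx /hy /hz !xpair_eqE /=.
case: ifP => [/andP[/eqP-> /eqP->]|k0] /=.
  rewrite !inE !xpair_eqE /=; case: d => [|[|[|d]]]; lia.
rewrite k0 /=; case: ifP => //= /and3P[c3 kgt0 ki].
have [->|k1] := eqVneq k 1%N.
  case: ifP => i1 /=; rewrite !inE !xpair_eqE;
   case: c c3 {k0} => [|[|[|c]]] // _; case: d => [|[|[|d]]]; lia.
case: ifP => i1 /=; rewrite !inE !xpair_eqE;
   case: c c3 {k0} => [|[|[|c]]] // _; case: d => [|[|[|d]]]; lia.
Qed.

(* The rays 0, 1, 2 are directed by (1, 0), (0, 1) and (-1, -1); the flag [b]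
   exchanges the first two, for the mirror image. *)
Definition ray (b : bool) (v : nat * nat) : nat :=
  let r := ((v.1 + ~~ odd v.2) %% 3)%N in
  if b then nth 0%N [:: 1; 0; 2]%N r else r.

(** * The radial drawing and its planarity *)

Section Drawing.
Variable R : realType.
Implicit Types (p q : R * R) (r s : nat) (a t : R).

Definition spoke r a : R * R :=
  if r == 0%N then (a, 0) else if r == 1%N then (0, a) else (- a, - a).

Definition radial (b : bool) (v : nat * nat) : R * R := spoke (ray b v) v.2%:R.

(** The gauge of the triangle with corners (1, 0), (0, 1) and (-1, -1): each linear form equals 1 on
    one side of it. *)
Definition level p : R :=
  Num.max (p.1 + p.2) (Num.max (p.1 - 2 * p.2) (p.2 - 2 * p.1)).

Lemma segmentC p q : segment p q = segment q p.
Proof.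
have sub p' q' : (segment p' q' `<=` segment q' p')%classic.
  move=> _ [t /andP[t0 t1] ->]; exists (1 - t); first by apply/andP; split; lra.
  by congr pair; ring.
by apply/seteqP; split; apply: sub.
Qed.

Lemma spokeM r a t : spoke r (t * a) = (t * (spoke r a).1, t * (spoke r a).2).
Proof. by rewrite /spoke; case: r => [|[|r]] /=; congr pair; ring. Qed.

Lemma spokeM1 r a t : t * (spoke r a).1 = (spoke r (t * a)).1.
Proof. by rewrite spokeM. Qed.

Lemma spokeM2 r a t : t * (spoke r a).2 = (spoke r (t * a)).2.
Proof. by rewrite spokeM. Qed.

(** Two rays lie in a common closed sector, where [level] is a single linear form with value [a] at
    [spoke r a]. *)
Lemma level_lerp r s a b t : 0 <= a -> 0 <= b -> 0 <= t <= 1 ->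
  level ((1 - t) * (spoke r a).1 + t * (spoke s b).1,
         (1 - t) * (spoke r a).2 + t * (spoke s b).2) = (1 - t) * a + t * b.
Proof.
move=> a0 b0 /andP[t0 t1].
have a'0 : 0 <= (1 - t) * a by rewrite mulr_ge0 // subr_ge0.
have b'0 : 0 <= t * b by rewrite mulr_ge0.
rewrite !spokeM1 !spokeM2; move: ((1 - t) * a) (t * b) a'0 b'0 => {}a {}b {}a0 {}b0.
rewrite /level /spoke; clear - a0 b0.
by case: r => [|[|r]]; case: s => [|[|s]] /=; rewrite /Num.max;
  case: ifP; case: ifP; move=> *; lra.
Qed.

Lemma level_radial b v : level (radial b v) = v.2%:R.
Proof.
have := @level_lerp (ray b v) 0 v.2%:R 0 0 (ler0n _ _) (lexx _).
rewrite /radial lexx ler01 => /(_ isT).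
by rewrite subr0 !mul1r !mul0r !addr0 -surjective_pairing.
Qed.

Lemma ray_lt3 b v : (ray b v < 3)%N.
Proof.
rewrite /ray; have : ((v.1 + ~~ odd v.2) %% 3 < 3)%N by rewrite ltn_mod.
by case: b => //; case: (_ %% _)%N => [|[|[|]]].
Qed.

Lemma spoke_inj r s a : (r < 3)%N -> (s < 3)%N -> 0 < a -> spoke r a = spoke s a -> r = s.
Proof.
rewrite /spoke => + + a0.
by case: r => [|[|[|]]] //; case: s => [|[|[|]]] // _ _ [] *; exfalso; lra.
Qed.

Lemma ray_inj b c d k : (c < 3)%N -> (d < 3)%N -> ray b (c, k) = ray b (d, k) -> c = d.
Proof.
rewrite /ray /=.
by case: c => [|[|[|]]] //; case: d => [|[|[|]]] // _ _; case: (odd k); case: b.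
Qed.

Lemma in_frakH_lt3 i v : in_frakH i v -> (v.1 < 3)%N.
Proof. by case/orP => [/eqP->|/and3P[]]. Qed.

Lemma in_frakH0 i v : in_frakH i v -> v.2 = 0%N -> v = hx 0.
Proof. by case/orP => [/eqP->//|/and3P[_ + _]] => /[swap] ->. Qed.

Lemma radial_inj b i : {in in_frakH i &, injective (radial b)}.
Proof.
move=> u v uH vH uv.
have e2 : u.2 = v.2.
  by apply/eqP; rewrite -(eqr_nat R) -!(level_radial b) uv.
have [u0|u0] := posnP u.2.
  by rewrite (in_frakH0 uH u0) (in_frakH0 vH) // -e2.
case: u v e2 u0 uH vH uv => [c k] [d l] /= <- k0 uH vH.
move/spoke_inj => /(_ (ray_lt3 _ _) (ray_lt3 _ _)).
rewrite ltr0n => /(_ k0)/ray_inj -> //; first exact: (in_frakH_lt3 uH).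
exact: (in_frakH_lt3 vH).
Qed.

Lemma level_edge b u v (t : R) : v.2 = u.2.+1 -> 0 <= t <= 1 ->
  level ((1 - t) * (radial b u).1 + t * (radial b v).1,
         (1 - t) * (radial b u).2 + t * (radial b v).2) = u.2%:R + t.
Proof. by move=> e t01; rewrite level_lerp ?ler0n // e -natr1; ring. Qed.

Lemma segment_l p q : segment p q p.
Proof. by exists 0; rewrite ?lexx ?ler01 //; case: p => x y /=; congr pair; ring. Qed.

Lemma edge_cross b i u v u' v' p :
  in_frakH i u -> in_frakH i v -> in_frakH i u' -> in_frakH i v' ->
  up u v -> up u' v' ->
  segment (radial b u) (radial b v) p -> segment (radial b u') (radial b v') p ->
  u = u' /\ v = v' \/
  exists w, [/\ w \in [:: u; v], w \in [:: u'; v'] & p = radial b w].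
Proof.
move=> uH vH u'H v'H uv u'v' [t t01 pE] [s s01 pE'].
have /andP[/eqP v2 _] := uv; have /andP[/eqP v'2 _] := u'v'.
have lE : u'.2%:R + s = u.2%:R + t.
  by rewrite -(level_edge b v2 t01) -(level_edge b v'2 s01) -pE -pE'.
have end0 (x y : R * R) : ((1 - 0) * x.1 + 0 * y.1, (1 - 0) * x.2 + 0 * y.2) = x.
  by case: x => x1 x2; congr pair => /=; ring.
have end1 (x y : R * R) : ((1 - 1) * x.1 + 1 * y.1, (1 - 1) * x.2 + 1 * y.2) = y.
  by case: y => x1 x2; congr pair => /=; ring.
move: (t01) (s01) => /andP[t0 t1] /andP[s0 s1].
have meet w w' : w \in [:: u; v] -> w' \in [:: u'; v'] -> p = radial b w -> p = radial b w' ->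
    u = u' /\ v = v' \/ exists w, [/\ w \in [:: u; v], w \in [:: u'; v'] & p = radial b w].
  move=> wI w'I pw pw'; right; exists w; split => //.
  suff -> : w = w' by [].
  apply: (@radial_inj b i); last by rewrite -pw -pw'.
  - by move: wI; rewrite !inE => /orP[]/eqP->.
  - by move: w'I; rewrite !inE => /orP[]/eqP->.
case: (ltngtP u.2 u'.2) => [lt|gt|e2].
(* The level of [p] is at most [u.2 + 1] on the first edge and at least [u'.2] on the second, so [p]
   is the upper end of one and the lower end of the other. *)
- have le : u.2%:R + 1 <= u'.2%:R :> R by rewrite natr1 ler_nat.
  have te : t = 1 by lra.
  have se : s = 0 by lra.
  by apply: (meet v u'); rewrite ?inE ?eqxx ?orbT //; [rewrite pE te end1 | rewrite pE' se end0].
- have le : u'.2%:R + 1 <= u.2%:R :> R by rewrite natr1 ler_nat.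
  have te : t = 0 by lra.
  have se : s = 1 by lra.
  by apply: (meet u v'); rewrite ?inE ?eqxx ?orbT //; [rewrite pE te end0 | rewrite pE' se end1].
have ts : s = t by move: lE; rewrite e2; lra.
subst s.
have [te|tn0] := eqVneq t 0.
  by apply: (meet u u'); rewrite ?inE ?eqxx ?orbT //; [rewrite pE te end0 | rewrite pE' te end0].
have [te|tn1] := eqVneq t 1.
  by apply: (meet v v'); rewrite ?inE ?eqxx ?orbT //; [rewrite pE te end1 | rewrite pE' te end1].
have {}t0 : 0 < t by rewrite lt_def tn0.
have {}t1 : 0 < 1 - t by rewrite subr_gt0 lt_def eq_sym tn1.
left; have [u0|u0] := posnP u.2.
  have uE := in_frakH0 uH u0; have u'E := in_frakH0 u'H (etrans (esym e2) u0).
  split; first by rewrite uE u'E.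
  have r0 : radial b (hx 0) = (0, 0) by rewrite /radial /ray; case: (b).
  apply: (@radial_inj b i) => //; move: pE pE'; rewrite uE u'E r0 => -> /= [].
  rewrite !mulr0 !add0r => e1 e3; move/(mulfI tn0): e1; move/(mulfI tn0): e3.
  by case: (radial b v) => ? ?; case: (radial b v') => ? ? /= -> ->.
move: pE; rewrite pE'; move: uv u'v'; rewrite /up v2 v'2 !eqxx /=.
rewrite -e2 !(gtn_eqF u0) /=.
move: (in_frakH_lt3 uH) (in_frakH_lt3 vH) (in_frakH_lt3 u'H) (in_frakH_lt3 v'H).
clear - u0 e2 v2 v'2 t0 t1.
case: u v u' v' u0 e2 v2 v'2 => [c k] [d l] [c' k'] [d' l'] /= k0 <- -> ->.
move=> c3 d3 c'3 d'3 cd c'd' [].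
rewrite /radial /= !spokeM1 !spokeM2.
have : 0 < (1 - t) * k%:R by rewrite mulr_gt0 // ltr0n.
have : 0 < t * k.+1%:R by rewrite mulr_gt0.
move: (t * _) ((1 - t) * _) => B A A0 B0.
(* [p] has positive coordinates [A] and [B] on the rays of the lower and upper ends. Between two
   given levels all edges that change ray turn in the same rotational sense, so even when [A = B]
   two of them cannot use the same two rays in opposite orders. *)
rewrite /spoke /ray /=; move: A0 B0 c3 d3 c'3 d'3 cd c'd'; clear.
by case: c => [|[|[|]]] //; case: d => [|[|[|]]] //; case: c' => [|[|[|]]] //;
  case: d' => [|[|[|]]] //; case: (odd k); case: b => A0 B0 _ _ _ _ _ _ e1 e2 //=; exfalso;
  move: e1 e2; rewrite /= => e1 e2; lra.
Qed.

(** A drawn vertex has integer level, whereas the level strictly inside an edge lies strictly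
    between consecutive integers. *)
Lemma edge_vertex b i u v w : in_frakH i u -> in_frakH i v -> in_frakH i w ->
  up u v -> segment (radial b u) (radial b v) (radial b w) -> w \in [:: u; v].
Proof.
move=> uH vH wH /andP[/eqP v2 _] [t t01 wE].
have := level_radial b w; rewrite wE (level_edge b v2 t01) => e.
have [t0 t1] := andP t01.
have [wu|uw] := leqP w.2 u.2.
  have : w.2%:R <= u.2%:R :> R by rewrite ler_nat.
  move=> ?; have t00 : t = 0 by lra.
  move: wE; rewrite t00 subr0 !mul1r !mul0r !addr0 -surjective_pairing.
  by move/(radial_inj wH uH) ->; rewrite inE eqxx.
have : u.2%:R + 1 <= w.2%:R :> R by rewrite natr1 ler_nat.
move=> ?; have t11 : t = 1 by lra.
move: wE; rewrite t11 subrr !mul1r !mul0r !add0r -surjective_pairing.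
by move/(radial_inj wH vH) ->; rewrite !inE eqxx orbT.
Qed.

Lemma perm_swap (T : eqType) (x y : T) : perm_eq [:: x; y] [:: y; x].
Proof. by apply/permP => a /=; rewrite addnCA. Qed.

(** The graph enters through its vertices and its adjacency, which [frakH i] and its mirror image
    share. Edges are first directed upwards, as [edge_cross] requires. *)
Lemma radial_planar b i (G : plane_graph (nat * nat)%type) :
  (forall v, (v \in vertices G) = in_frakH i v) ->
  (forall u v, adj G u v = [&& in_frakH i u, in_frakH i v & up u v || up v u]) ->
  planar_drawing G (radial b).
Proof.
move=> VG adjG; split.
- by move=> u v; rewrite !VG; apply: radial_inj.
- move=> u v w; rewrite adjG VG => /and3P[uH vH /orP[uv|vu]] wH.
    exact: (edge_vertex uH vH wH uv).
  by rewrite segmentC => /(edge_vertex vH uH wH vu); rewrite !inE orbC.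
- have half u v u' v' : in_frakH i u -> in_frakH i v -> up u v -> adj G u' v' ->
      ~~ perm_eq [:: u; v] [:: u'; v'] ->
      forall p, segment (radial b u) (radial b v) p ->
        segment (radial b u') (radial b v') p ->
      exists w, [/\ w \in [:: u; v], w \in [:: u'; v'] & p = radial b w].
    move=> uH vH uv; rewrite adjG => /and3P[u'H v'H /orP[uv'|vu']] ne p puv.
      case/(edge_cross uH vH u'H v'H uv uv' puv) => // -[eu ev].
      by move: ne; rewrite eu ev perm_refl.
    rewrite segmentC => /(edge_cross uH vH v'H u'H uv vu' puv)[[eu ev]|[w [wuv wuv' pw]]].
      by move: ne; rewrite eu ev perm_swap.
    by exists w; split => //; move: wuv'; rewrite !inE orbC.
  move=> u v u' v'; rewrite adjG => /and3P[uH vH /orP[uv|vu]] a' ne p.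
    exact: half.
  rewrite segmentC => puv puv'.
  have [|w [wvu wuv' pw]] := half _ _ _ _ vH uH vu a' _ p puv puv'.
    by move: ne; rewrite (permPl (perm_swap _ _)).
  by exists w; split => //; move: wvu; rewrite !inE orbC.
Qed.
End Drawing.

(** * Slopes, and their comparison by signs of coordinates *)

Section Slope.
Variable R : realType.
Implicit Types (p q : R * R) (a r t : R).

Lemma cos_sin_inj a t : 0 <= a < 2 * pi -> 0 <= t < 2 * pi ->
  cos a = cos t -> sin a = sin t -> a = t.
Proof.
wlog le_at : a t / a <= t.
  by move=> W ha ht ec es; case: (leP a t) => [|/ltW] h; [|symmetry]; apply: W.
move=> /andP[a0 _] /andP[_ t2] ec es; apply/eqP; rewrite eq_le le_at /= leNgt.
apply/negP => lt_at.
(* For half the difference, [cos (d + d) = 1] forces [sin d = 0], although 0 < d < pi. *)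
pose d := (t - a) / 2; have dE : t - a = d + d by rewrite /d; field.
have h3 : 0 < sin d by apply: sin_gt0_pi; apply/andP; split; rewrite /d; lra.
have : cos (t - a) = 1 by rewrite cosB ec es -!expr2 cos2Dsin2.
rewrite dE cosD -!expr2; move: (cos2Dsin2 d) => h1 h2.
have : sin d ^+ 2 = 0 by lra.
by move/eqP; rewrite sqrf_eq0 => /eqP h; rewrite h ltxx in h3.
Qed.

(** Polar coordinates are unique: summing the squares of both equations identifies the radii, and
    then the cosines and sines agree. *)
Lemma slope_eq p q a r : 0 <= a < 2 * pi -> 0 < r ->
  q.1 - p.1 = r * cos a -> q.2 - p.2 = r * sin a -> slope p q = a.
Proof.
move=> a01 r0 e1 e2; rewrite /slope.
case: xgetP => [t _ [t01 [s s0 [f1 f2]]]|/(_ a)[]]; last first.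
  by split => //; exists r.
have rs : r = s.
  apply/eqP; rewrite -(eqrXn2 (_ : 0 < 2)%N) ?ltW //; apply/eqP.
  rewrite -[LHS]mulr1 -(cos2Dsin2 a) -[RHS]mulr1 -(cos2Dsin2 t) !mulrDr -!exprMn.
  by rewrite -e1 -e2 -f1 -f2.
have rn0 : r != 0 by rewrite gt_eqF.
apply: cos_sin_inj => //; apply: (mulfI rn0).
  by rewrite -e1 rs -f1.
by rewrite -e2 rs -f2.
Qed.

Lemma slope_spec p q : p != q -> 0 <= slope p q < 2 * pi /\
  exists2 r, 0 < r & q.1 - p.1 = r * cos (slope p q) /\ q.2 - p.2 = r * sin (slope p q).
Proof.
move=> pq; apply: (@xgetPex _ 0 [set th : R | 0 <= th < 2 * pi /\
    exists2 r : R, 0 < r & q.1 - p.1 = r * cos th /\ q.2 - p.2 = r * sin th]%classic).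
set x := q.1 - p.1; set y := q.2 - p.2.
have xy : x ^+ 2 + y ^+ 2 != 0.
  rewrite paddr_eq0 ?sqr_ge0 // !sqrf_eq0 !subr_eq0; apply: contra pq.
  by case: (p) (q) => [p1 p2] [q1 q2] /= /andP[/eqP-> /eqP->].
have xy0 : 0 < x ^+ 2 + y ^+ 2 by rewrite lt_def xy addr_ge0 ?sqr_ge0.
pose r := Num.sqrt (x ^+ 2 + y ^+ 2).
have r0 : 0 < r by rewrite sqrtr_gt0.
have r2 : r ^+ 2 = x ^+ 2 + y ^+ 2 by rewrite sqr_sqrtr ?ltW.
have xr : -1 <= x / r <= 1.
  by rewrite ler_pdivlMr // ler_pdivrMr //; apply/andP; split; nra.
have cosE : r * cos (acos (x / r)) = x.
  by rewrite acosK ?in_itv //= mulrCA divff ?gt_eqF // mulr1.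
have sinE : r * sin (acos (x / r)) = `|y|.
  rewrite sin_acos // -(sqrtr_sqr y) -{1}[r]ger0_norm ?ltW // -(sqrtr_sqr r) -sqrtrM ?sqr_ge0 //.
  congr Num.sqrt; rewrite mulrBr mulr1 expr_div_n mulrCA divff ?mulr1 ?r2; last first.
    by rewrite -r2 sqrf_eq0 gt_eqF.
  by rewrite addrAC subrr add0r.
have ac0 := acos_ge0 xr; have acp := acos_lepi xr; have pi0 := pi_gt0 R.
have [y0|y0] := leP 0 y.
  exists (acos (x / r)); split; first by apply/andP; split; lra.
  by exists r => //; rewrite cosE sinE ger0_norm.
have acgt : 0 < acos (x / r).
  rewrite lt_def ac0 andbT; apply/eqP => ac; move: sinE; rewrite ac sin0 mulr0.
  by rewrite ltr0_norm // => h; lra.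
(* For a direction pointing downwards, [acos] gives the angle of its reflection in the horizontal
   axis. *)
exists (2 * pi - acos (x / r)); split; first by apply/andP; split; lra.
have -> : 2 * pi - acos (x / r) = - acos (x / r) + pi *+ 2 by rewrite -mulr_natl; ring.
exists r => //; rewrite cosD2pi sinD2pi cosN sinN cosE mulrN sinE ltr0_norm //.
by rewrite opprK.
Qed.

(** The vectors whose slope lies in [0, pi). *)
Definition upper p := (0 < p.2) || (p.2 == 0) && (0 < p.1).

Lemma slope_upper p q : p != q -> (slope p q < pi) = upper (q.1 - p.1, q.2 - p.2).
Proof.
move=> /slope_spec[/andP[]]; move: (slope p q) => t t0 t2 [r r0 [e1 e2]].
rewrite /upper /= e1 e2 pmulr_rgt0 // mulf_eq0 pmulr_rgt0 // gt_eqF //=.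
have [lt_tpi|le_pit] := ltP t pi.
  have [t00|tn0] := eqVneq t 0; first by rewrite t00 sin0 cos0 eqxx ltr01 orbT.
  by rewrite sin_gt0_pi // lt_def tn0 t0.
have [->|tnpi] := eqVneq t pi; first by rewrite sinpi cospi ltxx eqxx oppr_gt0 ltr10.
have : sin (t - pi) > 0.
  by apply: sin_gt0_pi; rewrite subr_gt0 lt_def tnpi le_pit /=; lra.
rewrite sinB sinpi cospi mulr0 subr0 mulrN1 oppr_gt0 => s0.
by rewrite lt_gtF // lt_eqF.
Qed.

Lemma slope_lt_half p q q' : p != q -> p != q' -> upper (q.1 - p.1, q.2 - p.2) ->
  ~~ upper (q'.1 - p.1, q'.2 - p.2) -> slope p q < slope p q'.
Proof.
by move=> pq pq'; rewrite -!slope_upper // -leNgt; apply: lt_le_trans.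
Qed.

(** The cross product is a positive multiple of the sine of the difference of the slopes; within one
    half-turn its sign decides their order. *)
Lemma slope_lt_cross p q q' :
  upper (q.1 - p.1, q.2 - p.2) = upper (q'.1 - p.1, q'.2 - p.2) ->
  0 < (q.1 - p.1) * (q'.2 - p.2) - (q.2 - p.2) * (q'.1 - p.1) ->
  slope p q < slope p q'.
Proof.
move=> uu cr.
have pq : p != q by apply: contraTneq cr => ->; rewrite !subrr !mul0r subrr ltxx.
have pq' : p != q' by apply: contraTneq cr => ->; rewrite !subrr !mulr0 subrr ltxx.
move: uu; rewrite -!slope_upper //.
move: cr; have [/andP[]] := slope_spec pq; have [/andP[]] := slope_spec pq'.
move: (slope p q) (slope p q') => a t t0 t2 [r r0 [-> ->]] a0 a2 [s s0 [-> ->]].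
rewrite (_ : _ - _ = s * r * sin (t - a)); last by rewrite sinB; ring.
rewrite pmulr_rgt0 ?mulr_gt0 // => sta h; rewrite ltNge; apply/negP => ta.
have : 0 <= sin (a - t); last by rewrite -opprB sinN; lra.
apply: sin_ge0_pi; rewrite subr_ge0 ta /=.
by case: ltP h => [? ht|? ht]; case: ltP ht => //; lra.
Qed.

End Slope.

(** * Angle-monotone paths along the rays *)

(** The preceding vertex on the same ray, along x_0, x_1, z_2, x_3 and the two similar paths; hence
    the dependence on parity. *)
Definition parent (v : nat * nat) : nat * nat :=
  if v.2 == 1%N then hx 0 else ((v.1 + (if odd v.2 then 2 else 1)) %% 3, v.2.-1)%N.

Lemma parent_level v : (0 < v.2)%N -> v.2 = (parent v).2.+1.
Proof. by rewrite /parent; case: eqP => [->//|_ /= v0]; lia. Qed.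

Lemma in_frakH_parent i v : in_frakH i v -> (0 < v.2)%N -> in_frakH i (parent v).
Proof.
rewrite /in_frakH /parent; case: v => c k /=; case: (k =P 1%N) => [-> //|k1].
rewrite /hx xpair_eqE; case/orP => [|/and3P[c3 k0 ki] _]; first by case: k {k1} => // k /andP[].
by apply/orP; right; rewrite ltn_mod /=; lia.
Qed.

Lemma up_parent i v : in_frakH i v -> (0 < v.2)%N -> up (parent v) v.
Proof.
move=> /in_frakH_lt3; case: v => c k /= c3 k0; apply/andP; split => /=.
  by rewrite -parent_level.
by rewrite /parent /=; case: (k =P 1%N) => //= _; case: c c3 => [|[|[|]]] // _; case: (odd k); rewrite orbT.
Qed.

Lemma ray_parent b v : (v.1 < 3)%N -> (1 < v.2)%N -> ray b (parent v) = ray b v.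
Proof.
case: v => c k /= c3 k1; rewrite /parent /= gtn_eqF // /ray /=.
case: k k1 => //= k k1.
by case: c c3 => [|[|[|]]] // _; case: (odd k); case: b.
Qed.

Section Monotone.
Variable R : realType.
Implicit Types (p q : R * R) (r s : nat) (beta a : R).

Lemma spokeB r (x y : R) : spoke r (x - y) = ((spoke r x).1 - (spoke r y).1, (spoke r x).2 - (spoke r y).2).
Proof. by rewrite /spoke; case: r => [|[|r]] /=; congr pair; ring. Qed.

Lemma radial_parent b v : (v.1 < 3)%N -> (0 < v.2)%N ->
  ((radial R b v).1 - (radial R b (parent v)).1, (radial R b v).2 - (radial R b (parent v)).2) =
  spoke (ray b v) 1.
Proof.
move=> v3 v0; have [v1|v1] := eqVneq v.2 1%N.
  rewrite /radial v1 {2 4}/parent v1 eqxx /=.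
  have z r : spoke r 0 = (0, 0) :> R * R by rewrite /spoke; case: r => [|[|r]] //=; rewrite oppr0.
  by rewrite z !subr0; case: (spoke _ _).
rewrite /radial ray_parent //; last by lia.
by rewrite -spokeB [in v.2%:R](parent_level v0) -natr1 addrAC subrr add0r.
Qed.

Definition wedge beta a : Prop :=
  exists k : int, beta - pi / 4 <= a + k%:~R * (2 * pi) <= beta + pi / 4.

Definition outward r : R :=
  if r == 0%N then 0 else if r == 1%N then pi / 2 else 5 * pi / 4.

Definition inward r : R :=
  if r == 0%N then pi else if r == 1%N then 3 * pi / 2 else pi / 4.

Lemma cos_sin_pi4 : cos (pi / 4) = sin (pi / 4) :> R /\ 0 < sin (pi / 4) :> R.
Proof.
have pi0 := pi_gt0 R; split; last by apply: sin_gt0_pi; apply/andP; split; lra.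
by rewrite -[RHS]cosBpihalf -cosN; congr cos; field.
Qed.

Lemma slope_outward b v : (v.1 < 3)%N -> (0 < v.2)%N ->
  slope (radial R b (parent v)) (radial R b v) = outward (ray b v).
Proof.
move=> v3 v0; have := radial_parent b v3 v0; have pi0 := pi_gt0 R.
rewrite /outward /spoke; case: (ray b v) (ray_lt3 b v) => [|[|[|]]] // _ /= [e1 e2].
- apply: (@slope_eq _ _ _ _ 1); rewrite ?cos0 ?sin0 ?mul1r //.
  by apply/andP; split; lra.
- apply: (@slope_eq _ _ _ _ 1); rewrite ?cos_pihalf ?sin_pihalf ?mul1r //.
  by apply/andP; split; lra.
- have [cs s0] := cos_sin_pi4.
  have e : 5 * pi / 4 = pi / 4 + pi :> R by field.
  (* The step (-1, -1) of ray 2 has length sqrt 2, the inverse of [sin (pi / 4)]. *)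
  apply: (@slope_eq _ _ _ _ (sin (pi / 4))^-1); rewrite ?invr_gt0 //.
  + by apply/andP; split; lra.
  + by rewrite e1 e cosDpi cs mulrN mulVf // gt_eqF.
  + by rewrite e2 e sinDpi mulrN mulVf // gt_eqF.
Qed.

Lemma slope_inward b v : (v.1 < 3)%N -> (0 < v.2)%N ->
  slope (radial R b v) (radial R b (parent v)) = inward (ray b v).
Proof.
move=> v3 v0; have := radial_parent b v3 v0; have pi0 := pi_gt0 R.
rewrite /inward /spoke; case: (ray b v) (ray_lt3 b v) => [|[|[|]]] // _ /= [/(congr1 -%R) + /(congr1 -%R)];
  rewrite !opprB => e1 e2.
- apply: (@slope_eq _ _ _ _ 1); rewrite ?cospi ?sinpi ?mul1r //; lra.
- have e : 3 * pi / 2 = pi / 2 + pi :> R by field.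
  apply: (@slope_eq _ _ _ _ 1); rewrite ?e ?cosDpi ?sinDpi ?cos_pihalf ?sin_pihalf ?mul1r //; lra.
- have [cs s0] := cos_sin_pi4.
  apply: (@slope_eq _ _ _ _ (sin (pi / 4))^-1); rewrite ?invr_gt0 ?cs ?mulVf ?gt_eqF //; lra.
Qed.

Lemma wedge_turn r s : (r < 3)%N -> (s < 3)%N -> r != s ->
  exists beta, wedge beta (inward r) /\ wedge beta (outward s).
Proof.
have pi0 := pi_gt0 R; rewrite /wedge /inward /outward.
case: r => [|[|[|]]] //; case: s => [|[|[|]]] // _ _ _ /=.
(* Between rays 0 and 1 the path turns by a right angle, and [beta] must bisect it. Otherwise it
   turns by pi / 4, and the inward slope serves. From ray 1 to ray 0, the slope 0 counts as 2 pi. *)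
- by exists (3 * pi / 4); split; exists 0%Z; rewrite mul0r; lra.
- by exists pi; split; exists 0%Z; rewrite mul0r; lra.
- by exists (7 * pi / 4); split; [exists 0%Z; rewrite mul0r|exists 1%Z; rewrite mul1r]; lra.
- by exists (3 * pi / 2); split; exists 0%Z; rewrite mul0r; lra.
- by exists (pi / 4); split; exists 0%Z; rewrite mul0r; lra.
- by exists (pi / 4); split; exists 0%Z; rewrite mul0r; lra.
Qed.

Lemma wedge_refl a : wedge a a.
Proof. by have pi0 := pi_gt0 R; exists 0%Z; rewrite mul0r; lra. Qed.

Section Graph.
Variables (b : bool) (i : nat) (G : plane_graph (nat * nat)%type).
Hypothesis VG : forall v, (v \in vertices G) = in_frakH i v.
Hypothesis adjG : forall u v,
  adj G u v = [&& in_frakH i u, in_frakH i v & up u v || up v u].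

Definition step beta : rel (nat * nat) :=
  fun u v => adj G u v && `[< in_wedge beta (radial R b u) (radial R b v) >].

(** Induction on the level of [v] through [parent v]; every edge has the slope of the ray, so one
    wedge condition covers them all. The vertex x_0 belongs to the three rays while [ray] assigns it
    one, hence the disjunction. *)
Lemma path_outward beta u v : in_frakH i u -> in_frakH i v ->
  u = hx 0 \/ ray b u = ray b v -> (u.2 <= v.2)%N -> wedge beta (outward (ray b v)) ->
  exists w, path (step beta) u w /\ last u w = v.
Proof.
move=> uH; have [k] : exists k, v.2 = k by exists v.2.
elim: k v => [|k IHk] v v2 vH uv le wv.
  exists [::]; split => //=; rewrite (in_frakH0 vH v2).
  by apply: (in_frakH0 uH); lia.
have [e|ne] := eqVneq u v; first by exists [::].
have v0 : (0 < v.2)%N by rewrite v2.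
have v3 := in_frakH_lt3 vH; have pH := in_frakH_parent vH v0.
have lt : (u.2 <= k)%N.
  rewrite -ltnS -v2 ltn_neqAle le andbT; apply: contra ne => /eqP e.
  case: uv => [u0|]; first by rewrite u0 in e; rewrite -e in v0.
  move: (in_frakH_lt3 uH) v3 e; case: (u) (v) => [c l] [d m] /= c3 d3 ->.
  by move/(ray_inj c3 d3) ->.
have last_step : step beta (parent v) v.
  rewrite /step adjG pH vH (up_parent vH v0) /=; apply/asboolP.
  by rewrite /in_wedge slope_outward.
have [k0|k0] := posnP k.
  exists [:: v]; split => //=; rewrite andbT.
  have -> : u = parent v; last exact: last_step.
  rewrite (in_frakH0 uH); last by lia.
  by rewrite (in_frakH0 pH) //; have := parent_level v0; lia.
have rp : ray b (parent v) = ray b v by rewrite ray_parent // v2.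
have [||||w [pw lw]] := IHk (parent v) _ pH.
- by have := parent_level v0; lia.
- by rewrite rp.
- by have := parent_level v0; lia.
- by rewrite rp.
by exists (rcons w v); rewrite last_rcons rcons_path pw lw.
Qed.

Lemma path_inward beta u v : in_frakH i u -> in_frakH i v ->
  v = hx 0 \/ ray b u = ray b v -> (v.2 <= u.2)%N -> wedge beta (inward (ray b u)) ->
  exists w, path (step beta) u w /\ last u w = v.
Proof.
move=> + vH; have [k] : exists k, u.2 = k by exists u.2.
elim: k u => [|k IHk] u u2 uH uv le wu.
  exists [::]; split => //=; rewrite (in_frakH0 uH u2).
  by symmetry; apply: (in_frakH0 vH); lia.
have [e|ne] := eqVneq u v; first by exists [::].
have u0 : (0 < u.2)%N by rewrite u2.
have u3 := in_frakH_lt3 uH; have pH := in_frakH_parent uH u0.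
have lt : (v.2 <= k)%N.
  rewrite -ltnS -u2 ltn_neqAle le andbT; apply: contra ne => /eqP e.
  case: uv => [v0|]; first by rewrite v0 in e; rewrite -e in u0.
  move: (in_frakH_lt3 vH) u3 e; case: (v) (u) => [c l] [d m] /= c3 d3 ->.
  by move/(ray_inj d3 c3) ->.
have first_step : step beta u (parent u).
  rewrite /step adjG pH uH (up_parent uH u0) orbT /=; apply/asboolP.
  by rewrite /in_wedge slope_inward.
have [k0|k0] := posnP k.
  exists [:: parent u]; split => //=; first by rewrite first_step.
  rewrite (in_frakH0 pH); last by have := parent_level u0; lia.
  by rewrite (in_frakH0 vH) //; lia.
have rp : ray b (parent u) = ray b u by rewrite ray_parent // u2.
have [||||w [pw lw]] := IHk (parent u) _ pH.
- by have := parent_level u0; lia.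
- by rewrite rp.
- by have := parent_level u0; lia.
- by rewrite rp.
by exists (parent u :: w); rewrite /= first_step.
Qed.

Lemma radial_angle_monotone : angle_monotone G (radial R b).
Proof.
move=> u v; rewrite !VG => uH vH.
suff [beta [w [pw lw]]] : exists beta w, path (step beta) u w /\ last u w = v.
  (* Cutting loops out of a walk keeps every remaining step in the wedge. *)
  case/shortenP: pw lw => w' pw' uw' _ lw'; exists beta, w'; split => //.
    by apply: sub_path pw' => x y /andP[].
  by apply: sub_path pw' => x y /andP[].
have [ruv|ruv] := eqVneq (ray b u) (ray b v).
  have [uv|/ltnW vu] := leqP u.2 v.2.
    exists (outward (ray b v)); apply: path_outward => //; first by right.
    exact: wedge_refl.
  exists (inward (ray b u)); apply: path_inward => //; first by right.
  exact: wedge_refl.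
have [beta [wu wv]] := wedge_turn (ray_lt3 b u) (ray_lt3 b v) ruv.
have H0 : in_frakH i (hx 0) by [].
have [w [pw lw]] := path_inward uH H0 (or_introl erefl) (leq0n _) wu.
have [w' [pw' lw']] := path_outward H0 vH (or_introl erefl) (leq0n _) wv.
by exists beta, (w ++ w'); rewrite cat_path last_cat lw pw.
Qed.
End Graph.
End Monotone.

(** * Circular orders of the edges around the vertices *)

Section Orders.
Variable R : realType.
Implicit Types (p q : R * R).

Lemma upper_sub p q : upper (p.1 - q.1, p.2 - q.2) ->
  p != q /\ ~~ upper (q.1 - p.1, q.2 - p.2).
Proof.
rewrite /upper /= !subr_gt0 !subr_eq0 => /orP[lt|/andP[/eqP eq lt]]; split.
- by apply: contraTneq lt => ->; rewrite ltxx.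
- by rewrite lt_gtF //= lt_eqF.
- by apply: contraTneq lt => ->; rewrite ltxx.
- by rewrite eq ltxx eqxx lt_gtF.
Qed.

Lemma slope_lt_turn p q q' : upper (q.1 - p.1, q.2 - p.2) ->
  upper (p.1 - q'.1, p.2 - q'.2) -> slope p q < slope p q'.
Proof.
move=> pq /upper_sub[pq' npq']; have [qp _] := upper_sub pq.
by apply: slope_lt_half; rewrite // eq_sym.
Qed.

Lemma slope_lt_upper p q q' : upper (q.1 - p.1, q.2 - p.2) ->
  upper (q'.1 - p.1, q'.2 - p.2) ->
  0 < (q.1 - p.1) * (q'.2 - p.2) - (q.2 - p.2) * (q'.1 - p.1) ->
  slope p q < slope p q'.
Proof. by move=> uq uq'; apply: slope_lt_cross; rewrite uq uq'. Qed.

Lemma slope_lt_lower p q q' : upper (p.1 - q.1, p.2 - q.2) ->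
  upper (p.1 - q'.1, p.2 - q'.2) ->
  0 < (q.1 - p.1) * (q'.2 - p.2) - (q.2 - p.2) * (q'.1 - p.1) ->
  slope p q < slope p q'.
Proof.
move=> /upper_sub[_ /negbTE uq] /upper_sub[_ /negbTE uq'].
by apply: slope_lt_cross; rewrite uq uq'.
Qed.

Ltac upper_lra := rewrite /upper /=; apply/orP;
  first [left; lra | right; apply/andP; split; [apply/eqP; lra | lra]].

Ltac slope_lra :=
  first [ apply: slope_lt_turn; upper_lra
        | apply: slope_lt_upper; [upper_lra | upper_lra | rewrite /=; nra]
        | apply: slope_lt_lower; [upper_lra | upper_lra | rewrite /=; nra] ].

Ltac sorted_lra odd_k :=
  rewrite /= ?odd_k /= -?natr1; repeat (apply/andP; split); rewrite ?andbT //; slope_lra.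

(** A vertex has at most four neighbours, so a rotation by at most 3 puts the smallest slope
    first. *)
Ltac circular_lra odd_k :=
  first [exists 0%N; sorted_lra odd_k | exists 1%N; sorted_lra odd_k
        | exists 2%N; sorted_lra odd_k | exists 3%N; sorted_lra odd_k].

Lemma radial_circular_orders b i (G : plane_graph (nat * nat)%type) : (1 <= i)%N ->
  (forall v, (v \in vertices G) = in_frakH i v) ->
  (forall v, nbrs G v = if b then rev (frakH_nbrs i v) else frakH_nbrs i v) ->
  same_circular_orders G (radial R b).
Proof.
move=> i1 VG nG v; rewrite VG nG => vH; have v3 := in_frakH_lt3 vH.
rewrite /frakH_nbrs vH; have [->|v0] := eqVneq v (hx 0).
  by rewrite /radial /hx /hy /hz; case: b {nG}; rewrite /ray /= /spoke /=;
    circular_lra (erefl false).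
case: v v3 v0 vH => c k c3 v0 vH.
have k0 : (0 < k)%N.
  by rewrite lt0n; apply: contra v0 => /eqP k0; rewrite k0 in vH *; rewrite (in_frakH0 vH).
move: c3; rewrite /= => c3; clear - c3 k0 i1; case: k k0 => // k _.
have [k0|k0] := eqVneq k 0%N.
  rewrite k0 eqxx i1.
  case: c c3 => [|[|[|]]] // _; case: b; rewrite /radial /= /ray /= /spoke /=;
    circular_lra (erefl false).
case: k k0 {i1} => // k _.
have K0 : 0 <= k%:R :> R by exact: ler0n.
(* Once parity, membership in the top level, letter and orientation are fixed, the rays are known
   and the coordinates are affine in [k]. *)
case ok: (odd k); case: (_ < _)%N; case: c c3 => [|[|[|]]] // _; case: b;
  rewrite /radial /= /ray /= /spoke /= ok /=;
  circular_lra ok.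
Qed.
End Orders.

(** * The outer face of a drawing enclosed in a star-shaped region *)

Section OuterFace.
Variable R : realType.
Implicit Types (p q : R * R) (P Q : set (R * R)).

Lemma connected_half_line p :
  connected [set q : R * R | exists2 t : R, 1 <= t & q = t *: p].
Proof.
have -> : [set q | exists2 t : R, 1 <= t & q = t *: p] =
    (fun t : R => t *: p) @` `[1, +oo[%classic.
  apply/seteqP; split => [q [t t1 ->]|q [t /=]].
    by exists t => //=; rewrite in_itv /= t1.
  by rewrite in_itv /= andbT => t1 <-; exists t.
apply: connected_continuous_connected.
  by apply/connected_intervalP; exact: interval_is_interval.
by apply: continuous_subspaceT => t; apply: cvgZr_tmp => //; exact: cvg_id.
Qed.

Lemma half_line_unbounded p : p != 0 ->
  ~ bounded_set [set q : R * R | exists2 t : R, 1 <= t & q = t *: p].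
Proof.
move=> p0 /pinfty_ex_gt0[M M0 /= MP].
have np : 0 < `|p| by rewrite normr_gt0.
have : `|(M / `|p| + 1) *: p| <= M.
  by apply: MP; exists (M / `|p| + 1) => //; rewrite lerDr divr_ge0 // ltW.
rewrite normrZ ger0_norm; last by rewrite addr_ge0 // divr_ge0 // ltW.
by rewrite mulrDl mulfVK ?gt_eqF // mul1r gerDl leNgt np.
Qed.

(** [P] stands for the region enclosed by the outer cycle, [Q] for the closure of its complement,
    and their intersection for the cycle itself. *)
Lemma outer_face_boundary (T : choiceType) (G : plane_graph T) (D : T -> R * R) P Q :
  closed P -> closed Q -> P `|` Q = setT -> bounded_set P -> P 0 ->
  (forall p t, P p -> 0 <= t <= 1 -> P (t *: p)) ->
  Q `<=` closure (~` P) ->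
  drawing_points G D `<=` P -> P `&` Q `<=` drawing_points G D ->
  closure (outer_face G D) `\` (outer_face G D)° = P `&` Q.
Proof.
move=> cP cQ PQ bP P0 starP QP DP PQD.
have PorQ x : P x \/ Q x by have : (P `|` Q) x by rewrite PQ.
have -> : outer_face G D = ~` P.
  apply/seteqP; split => [p [npD nb] Pp|p nPp].
    have nQp : ~ Q p by move=> Qp; apply: npD; apply: PQD.
    apply: nb; have CP : connected_component (~` drawing_points G D) p `<=` P.
      set C := connected_component _ p.
      (* Within the connected set [C], [P] is closed, and also open because [C] avoids the drawing
         and hence [P] coincides there with the complement of [Q]. *)
      have <- : C `&` P = C; last by move=> x [].
      apply: (@component_connected _ (~` drawing_points G D) p).
      - by exists p; split => //; apply: connected_component_refl.
      - exists (~` Q); first exact: closed_openC.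
        apply/seteqP; split => x [Cx Px]; split => //.
          by move=> Qx; apply: (connected_component_sub Cx); apply: PQD.
        by case: (PorQ x).
      - by exists P.
    move: bP; rewrite /= /bounded_near; apply: filterS => M MP x Cx.
    by apply: MP; apply: CP.
  split; first by move/DP.
  have p0 : p != 0 by apply: contra_notN nPp => /eqP->.
  move=> bC; apply: (half_line_unbounded p0).
  move: bC; rewrite /= /bounded_near; apply: filterS => M MC x xp; apply: MC.
  suff : [set q : R * R | exists2 t : R, 1 <= t & q = t *: p] `<=`
    connected_component (~` drawing_points G D) p by apply.
  apply: connected_component_max; last exact: connected_half_line.
    by exists 1 => //; rewrite scale1r.
  (* Were [t *: p] in [P], shrinking it by the factor 1 / t <= 1 would put [p] in [P]. *)
  move=> _ [t t1 ->] /DP Ptp; apply: nPp.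
  have t0 : 0 < t by apply: lt_le_trans t1.
  rewrite -[p](scalerK (lt0r_neq0 t0)); apply: starP => //.
  by rewrite invr_ge0 ltW //= invf_le1.
rewrite interiorC (_ : closure P = P); last by symmetry; apply/closure_id.
apply/seteqP; split => x [].
  move=> cPx /contrapT Px; split => //; apply: contrapT => nQx.
  have [y [nPy nQy]] := cPx _ (open_nbhs_nbhs (conj (closed_openC cQ) nQx)).
  by case: (PorQ y).
by move=> Px Qx; split; [apply: QP|].
Qed.
End OuterFace.

(** * The pinwheel and its boundary *)

Section Pinwheel.
Variable R : realType.
Implicit Types (p q : R * R) (r s : nat) (a b c t : R).

Definition half_plane a b c : set (R * R) := [set p | a * p.1 + b * p.2 <= c].

Lemma closed_half_plane a b c : closed (half_plane a b c).
Proof.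
apply: (@closed_comp _ _ (fun p : R * R => a * p.1 + b * p.2) [set x | x <= c]);
  last exact: closed_le.
move=> p _; apply: cvgD; apply: cvgMl_tmp; [exact: cvg_fst|exact: cvg_snd].
Qed.

Lemma half_plane_scale a b c p t : 0 <= c -> half_plane a b c p -> 0 <= t <= 1 ->
  half_plane a b c (t *: p).
Proof.
rewrite /half_plane /= => c0 pc /andP[t0 t1].
rewrite -![_ *: _]/(t * _).
have -> : a * (t * p.1) + b * (t * p.2) = t * (a * p.1 + b * p.2) by ring.
apply: (le_trans (ler_wpM2l t0 pc)); exact: ler_piMl.
Qed.

(** The closed sector from ray [r] to the next ray modulo 3. *)
Definition sector r : set (R * R) :=
  if r == 0%N then half_plane (-1) 0 0 `&` half_plane 0 (-1) 0
  else if r == 1%N then half_plane 1 (-1) 0 `&` half_plane 1 0 0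
  else half_plane 0 1 0 `&` half_plane (-1) 1 0.

Lemma segment_radial r (a x y : R) : x != y -> x <= a <= y \/ y <= a <= x ->
  segment (spoke r x) (spoke r y) (spoke r a).
Proof.
move=> xy; wlog le : x y xy / x <= y => [W|].
  have [|/ltW yx] := leP x y; first exact: W.
  by rewrite segmentC => /or_comm; apply: W; rewrite // eq_sym.
have {xy le} lt : x < y by rewrite lt_neqAle xy.
have yx0 : 0 < y - x by rewrite subr_gt0.
move=> h; have {h} /andP[xa ay] : x <= a <= y by case: h => // h; lra.
exists ((a - x) / (y - x)).
  rewrite divr_ge0 ?subr_ge0 //=; last exact: ltW lt.
  by rewrite ler_pdivrMr // mul1r lerD2r.
have ne : y - x != 0 by rewrite gt_eqF.
have e : (1 - (a - x) / (y - x)) * x + (a - x) / (y - x) * y = a by field.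
have e' : (1 - (a - x) / (y - x)) * (- x) + (a - x) / (y - x) * (- y) = - a by field.
by rewrite /spoke; case: r => [|[|r]] /=; rewrite ?e ?e' ?mulr0 ?addr0.
Qed.

Section Params.
Variables u w : R.

(** The bounding line passes through [spoke r u] and the point at distance parameter [w] on the next
    ray; for positive [u] and [w] this is the side of the origin, and [above] is the other side. *)
Definition below r : set (R * R) :=
  if r == 0%N then half_plane w u (u * w)
  else if r == 1%N then half_plane (- (u + w)) w (u * w)
  else half_plane u (- (u + w)) (u * w).

Definition above r : set (R * R) :=
  if r == 0%N then half_plane (- w) (- u) (- (u * w))
  else if r == 1%N then half_plane (u + w) (- w) (- (u * w))
  else half_plane (- u) (u + w) (- (u * w)).

(* The union of the triangles with vertices the origin, [spoke r u] and
   [spoke r.+1 w]; [pinwheel_out] is the closure of its complement. *)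
Definition pinwheel : set (R * R) :=
  (sector 0 `&` below 0) `|` (sector 1 `&` below 1) `|` (sector 2 `&` below 2).

Definition pinwheel_out : set (R * R) :=
  (sector 0 `&` above 0) `|` (sector 1 `&` above 1) `|` (sector 2 `&` above 2).

(** Six sides: one across each sector, and on each ray the stretch between the reaches [u] and [w]
    of the two triangles that meet along it. *)
Definition pinwheel_boundary : set (R * R) :=
  [set p | exists2 r, (r < 3)%N &
    segment (spoke r u) (spoke (r.+1 %% 3) w) p \/ segment (spoke r u) (spoke r w) p].

Lemma closed_pinwheel : closed pinwheel.
Proof. by do 2?apply: closedU; do !apply: closedI; apply: closed_half_plane. Qed.

Lemma closed_pinwheel_out : closed pinwheel_out.
Proof. by do 2?apply: closedU; do !apply: closedI; apply: closed_half_plane. Qed.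

Lemma pinwheel_cover : pinwheel `|` pinwheel_out = setT.
Proof.
rewrite -subTset => p _.
have [r r3 pr] : exists2 r, (r < 3)%N & sector r p.
  have [x0|x0] := leP 0 p.1; have [y0|y0] := leP 0 p.2.
  - by exists 0%N => //; split; rewrite /half_plane /=; lra.
  - by exists 2%N => //; split; rewrite /half_plane /=; lra.
  - by exists 1%N => //; split; rewrite /half_plane /=; lra.
  have [xy|xy] := leP p.1 p.2.
  - by exists 1%N => //; split; rewrite /half_plane /=; lra.
  - by exists 2%N => //; split; rewrite /half_plane /=; lra.
have : below r p \/ above r p.
  case: r r3 {pr} => [|[|[|]]] // _; rewrite /below /above /half_plane /=.
  - by have [h|/ltW h] := leP (w * p.1 + u * p.2) (u * w); [left|right; lra].
  - by have [h|/ltW h] := leP (- (u + w) * p.1 + w * p.2) (u * w); [left|right; lra].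
  - by have [h|/ltW h] := leP (u * p.1 - (u + w) * p.2) (u * w); [left; lra|right; lra].
case: r r3 pr => [|[|[|]]] // _ pr [pb|pa].
all: try by left; do ?[by left; split|by right; split|left].
all: try by right; do ?[by left; split|by right; split|left].
Qed.

Ltac pinwheel_lra :=
  first [ by left; left; do !split; rewrite /below /above /half_plane /=; lra
        | by left; right; do !split; rewrite /below /above /half_plane /=; lra
        | by right; do !split; rewrite /below /above /half_plane /=; lra ].

Hypotheses (u0 : 0 < u) (w0 : 0 < w).

Lemma pinwheel_scale p t : pinwheel p -> 0 <= t <= 1 -> pinwheel (t *: p).
Proof.
have uw0 : 0 <= u * w by rewrite mulr_ge0 // ltW.
move=> + t01; case=> [[[[h1 h2] h3]|[[h1 h2] h3]]|[[h1 h2] h3]];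
  [left; left|left; right|right]; do !split; exact: half_plane_scale.
Qed.

Lemma pinwheel0 : pinwheel 0.
Proof.
have uw0 : 0 <= u * w by rewrite mulr_ge0 // ltW.
rewrite (_ : (0 : R * R) = (0, 0)) //; left; left.
by do !split; rewrite /below /half_plane /= !mulr0 addr0.
Qed.

Lemma pinwheel_norm p : pinwheel p -> `|p| <= u + w.
Proof.
(* Here [x] and [y] are the coordinates of a point of a triangle in the basis of its two ray
   directions. *)
have bd x y : 0 <= x -> 0 <= y -> w * x + u * y <= u * w -> x <= u /\ y <= w.
  move=> x0 y0 xy; split.
    rewrite -(ler_pM2l w0); have := mulr_ge0 (ltW u0) y0; lra.
  rewrite -(ler_pM2l u0); have := mulr_ge0 (ltW w0) x0; lra.
rewrite prod_normE ge_max !ler_norml.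
case=> [[[[h1 h2] h3]|[[h1 h2] h3]]|[[h1 h2] h3]]; move: h1 h2 h3;
  rewrite /below /above /half_plane /= => h1 h2 h3.
- by have [|||? ?] := bd p.1 p.2; lra.
- by have [|||? ?] := bd (p.2 - p.1) (- p.1); lra.
- by have [|||? ?] := bd (- p.2) (p.1 - p.2); lra.
Qed.

Lemma bounded_pinwheel : bounded_set pinwheel.
Proof.
exists (u + w); split; first exact: num_real.
by move=> M /ltW uM p /pinwheel_norm /le_trans; apply.
Qed.

Lemma pinwheel_out_closure : pinwheel_out `<=` closure (~` pinwheel).
Proof.
have push (d : R) x y p : 0 < d -> `|x| <= 1 -> `|y| <= 1 -> ball p d (p.1 + d / 2 * x, p.2 + d / 2 * y).
  move=> d0 x1 y1; split; rewrite /ball /= opprD addNKr normrN normrM ger0_norm; nra.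
move=> p pout B /nbhs_ballP[d /= d0 dB].
have h0 : 0 < d / 2 by rewrite divr_gt0.
have hu : 0 < u * (d / 2) by rewrite mulr_gt0.
have hw : 0 < w * (d / 2) by rewrite mulr_gt0.
(* Moving along the bisector of the sector leaves the pinwheel, even from a
   point of a ray, where the neighbouring triangle may reach further. *)
case: pout => [[[[h1 h2] h3]|[[h1 h2] h3]]|[[h1 h2] h3]].
- exists (p.1 + d / 2 * 1, p.2 + d / 2 * 1); split; last first.
    by apply/dB/push => //; rewrite normr1.
  move: h1 h2 h3; rewrite /below /above /half_plane /= => h1 h2 h3.
  by case=> [[[[g1 g2] g3]|[[g1 g2] g3]]|[[g1 g2] g3]]; move: g1 g2 g3;
  rewrite /below /above /half_plane /= => g1 g2 g3; lra.
- exists (p.1 + d / 2 * (-1), p.2 + d / 2 * 0); split; last first.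
    by apply/dB/push => //; rewrite ?normrN ?normr1 ?normr0.
  move: h1 h2 h3; rewrite /below /above /half_plane /= => h1 h2 h3.
  by case=> [[[[g1 g2] g3]|[[g1 g2] g3]]|[[g1 g2] g3]]; move: g1 g2 g3;
  rewrite /below /above /half_plane /= => g1 g2 g3; lra.
- exists (p.1 + d / 2 * 0, p.2 + d / 2 * (-1)); split; last first.
    by apply/dB/push => //; rewrite ?normrN ?normr1 ?normr0.
  move: h1 h2 h3; rewrite /below /above /half_plane /= => h1 h2 h3.
  by case=> [[[[g1 g2] g3]|[[g1 g2] g3]]|[[g1 g2] g3]]; move: g1 g2 g3;
  rewrite /below /above /half_plane /= => g1 g2 g3; lra.
Qed.
Lemma segment_cross r s (x y : R) : 0 <= x -> 0 <= y -> w * x + u * y = u * w ->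
  segment (spoke r u) (spoke s w)
    ((spoke r x).1 + (spoke s y).1, (spoke r x).2 + (spoke s y).2).
Proof.
move=> x_ge0 y_ge0 xy; have un0 : u != 0 by rewrite gt_eqF.
have wn0 : w != 0 by rewrite gt_eqF.
(* The weight of the second end; the hypothesis [xy] makes that of the first end x / u. *)
exists (y / w).
  rewrite divr_ge0 ?(ltW w0) //= ler_pdivrMr // mul1r -(ler_pM2l u0) -xy lerDr.
  by rewrite mulr_ge0 // ltW.
have e : (1 - y / w) * u = x.
  apply: (mulfI wn0); rewrite (_ : w * ((1 - y / w) * u) = u * w - u * y); last by field.
  by rewrite -xy; ring.
have e' : y / w * w = y by field.
by rewrite !spokeM1 !spokeM2 e e'.
Qed.

(** If a point is in both sets through the same sector, it is on the side across that sector. If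
    through two sectors, it is on their common ray, within the reach of one triangle and not short
    of the other's. *)
Lemma pinwheel_boundaryE : u != w ->
  pinwheel `&` pinwheel_out = pinwheel_boundary.
Proof.
move=> uw.
have leu a : (w * a <= u * w) = (a <= u) by rewrite mulrC ler_pM2r.
have lew a : (u * a <= u * w) = (a <= w) by rewrite ler_pM2l.
have geu a : (u * w <= w * a) = (u <= a) by rewrite mulrC ler_pM2l.
have gew a : (u * w <= u * a) = (w <= a) by rewrite ler_pM2l.
have onray r a p : (r < 3)%N -> p = spoke r a -> u <= a <= w \/ w <= a <= u ->
    pinwheel_boundary p.
  by move=> r3 -> h; exists r => //; right; apply: segment_radial.
have oncross r x y p : (r < 3)%N -> 0 <= x -> 0 <= y -> w * x + u * y = u * w ->
    p = ((spoke r x).1 + (spoke (r.+1 %% 3) y).1, (spoke r x).2 + (spoke (r.+1 %% 3) y).2) ->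
    pinwheel_boundary p.
  by move=> r3 x_ge0 y_ge0 e ->; exists r => //; left; apply: segment_cross.
apply/seteqP; split => [[x y]|p].
  case=> [[[[[h1 h2] h3]|[[h1 h2] h3]]|[[h1 h2] h3]]
          [[[[g1 g2] g3]|[[g1 g2] g3]]|[[g1 g2] g3]]];
  move: h1 h2 h3 g1 g2 g3; rewrite /below /above /half_plane /= => h1 h2 h3 g1 g2 g3.
  - by apply: (oncross 0%N x y); [by []|lra|lra|lra|by rewrite /spoke /=; congr pair; ring].
  - have z : x = 0 by lra.
    rewrite {}z in h1 h2 h3 g1 g2 g3 *.
    apply: (onray 1%N y); [by []|by rewrite /spoke /=; congr pair; lra|].
    by left; rewrite -lew -geu; apply/andP; split; lra.
  - have z : y = 0 by lra.
    rewrite {}z in h1 h2 h3 g1 g2 g3 *.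
    apply: (onray 0%N x); [by []|by rewrite /spoke /=; congr pair; lra|].
    by right; rewrite -leu -gew; apply/andP; split; lra.
  - have z : x = 0 by lra.
    rewrite {}z in h1 h2 h3 g1 g2 g3 *.
    apply: (onray 1%N y); [by []|by rewrite /spoke /=; congr pair; lra|].
    by right; rewrite -leu -gew; apply/andP; split; lra.
  - apply: (oncross 1%N (y - x) (- x)); [by []|lra|lra|lra|by rewrite /spoke /=; congr pair; ring].
  - have z : y = x by lra.
    rewrite {}z in h1 h2 h3 g1 g2 g3 *.
    apply: (onray 2%N (- x)); [by []|by rewrite /spoke /=; congr pair; lra|].
    by left; rewrite -lew -geu; apply/andP; split; lra.
  - have z : y = 0 by lra.
    rewrite {}z in h1 h2 h3 g1 g2 g3 *.
    apply: (onray 0%N x); [by []|by rewrite /spoke /=; congr pair; lra|].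
    by left; rewrite -lew -geu; apply/andP; split; lra.
  - have z : y = x by lra.
    rewrite {}z in h1 h2 h3 g1 g2 g3 *.
    apply: (onray 2%N (- x)); [by []|by rewrite /spoke /=; congr pair; lra|].
    by right; rewrite -leu -gew; apply/andP; split; lra.
  - apply: (oncross 2%N (- y) (x - y)); [by []|lra|lra|lra|by rewrite /spoke /=; congr pair; ring].
case=> r r3 [] [t /andP[t0 t1] ->].
- have tw : 0 <= t * w by rewrite mulr_ge0 // ltW.
  have tu : 0 <= (1 - t) * u by rewrite mulr_ge0 ?subr_ge0 // ltW.
  rewrite !spokeM1 !spokeM2.
  have e : w * ((1 - t) * u) + u * (t * w) = u * w by ring.
  move: (t * w) ((1 - t) * u) e tw tu => y x e y0 x0.
  by case: r r3 => [|[|[|]]] // _; rewrite /spoke /= ?addr0 ?add0r; split; pinwheel_lra.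
rewrite !spokeM1 !spokeM2 (_ : (_, _) = spoke r ((1 - t) * u + t * w)); last first.
  by rewrite /spoke; case: r {r3} => [|[|r]] /=; congr pair; ring.
set a := _ + _.
have a0 : 0 <= a by rewrite addr_ge0 // mulr_ge0 ?subr_ge0 // ltW.
have : (w * a <= u * w /\ u * w <= u * a) \/ (u * a <= u * w /\ u * w <= w * a).
  rewrite leu gew lew geu /a.
  have [uw'|/ltW wu] := leP u w; [right|left]; split; nra.
have uu0 := mulr_ge0 (ltW u0) a0; have ww0 := mulr_ge0 (ltW w0) a0.
case: r r3 => [|[|[|]]] // _; rewrite /spoke /= => -[[h1 h2]|[h1 h2]]; split;
  pinwheel_lra.
Qed.

(** The point has level [x + y]: the pinwheel contains all points of level at most the smaller of
    [u] and [w]. *)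
Lemma comb_pinwheel r s (x y : R) : (r < 3)%N -> (s < 3)%N -> 0 <= x -> 0 <= y ->
  x + y <= u -> x + y <= w ->
  pinwheel ((spoke r x).1 + (spoke s y).1, (spoke r x).2 + (spoke s y).2).
Proof.
move=> r3 s3 x_ge0 y_ge0 xyu xyw.
have [h1 h2] : w * x + u * y <= u * w /\ w * y + u * x <= u * w.
  have [uw|/ltW wu] := leP u w.
    have := ler_wpM2l (ltW w0) xyu; have := ler_wpM2r x_ge0 uw; have := ler_wpM2r y_ge0 uw; lra.
  have := ler_wpM2l (ltW u0) xyw; have := ler_wpM2r x_ge0 wu; have := ler_wpM2r y_ge0 wu; lra.
have hw : w * (x + y) <= u * w by rewrite mulrC ler_pM2r.
by case: r r3 => [|[|[|]]] // _; case: s s3 => [|[|[|]]] // _; rewrite /spoke /=; pinwheel_lra.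
Qed.
End Params.
End Pinwheel.

(** * The outer hexagon as the boundary of a pinwheel *)

Lemma next_hcycle i v : v \in hcycle i ->
  next (hcycle i) v = ((v.1 + 2) %% 3, if v.2 == i then i.+1 else i)%N.
Proof.
have n1 : (i == i.+1) = false by lia.
have n2 : (i.+1 == i) = false by lia.
rewrite !inE /hx /hy /hz => /or4P[|||/or3P[]] /eqP->;
  by rewrite /next /hcycle /hx /hy /hz /= !xpair_eqE /= ?eqxx ?n1 ?n2 ?eqxx ?n1 ?n2.
Qed.

Lemma mem_hcycle i v : (v \in hcycle i) = (v.1 < 3)%N && ((v.2 == i) || (v.2 == i.+1)).
Proof.
rewrite !inE /hx /hy /hz; case: v => c k; rewrite !xpair_eqE /=.
by case: c => [|[|[|c]]] //=; lia.
Qed.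

Lemma uniq_hcycle i : uniq (hcycle i).
Proof. by rewrite /hcycle /= !inE /hx /hy /hz !xpair_eqE /=; lia. Qed.

Section Boundary.
Variable R : realType.
Variables (b : bool) (i : nat).
Hypothesis i1 : (1 <= i)%N.

Let e := odd i (+) b.
(* The cross edges of the hexagon [hcycle i] join [spoke r cross_start] to
   [spoke r.+1 cross_end]. *)
Definition cross_start : R := (e + i)%:R.
Definition cross_end : R := (~~ e + i)%:R.
Local Notation u := cross_start.
Local Notation w := cross_end.

(** An edge between the two top levels stays on a ray or crosses a sector. The parity of [i] and the
    flag [b] fix the sense in which the crossing edges turn, hence which of i and i + 1 is [u]. *)
Lemma top_edge_boundary x y : in_frakH i x -> in_frakH i y -> up x y -> x.2 = i ->
  segment (radial R b x) (radial R b y) `<=` pinwheel_boundary u w.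
Proof.
move=> /in_frakH_lt3 + /in_frakH_lt3 + /andP[/eqP + +] xi; rewrite xi gtn_eqF //=.
case: x y xi => [c k] [d l] /= -> c3 d3 -> + p; rewrite /cross_start /cross_end /e /radial /ray /=.
rewrite /pinwheel_boundary.
case: (odd i); case: b; case: c c3 => [|[|[|]]] // _; case: d d3 => [|[|[|]]] // _ _ pP;
first [ by exists 0%N => //; left | by exists 0%N => //; right | by exists 0%N => //; left; rewrite segmentC
      | by exists 0%N => //; right; rewrite segmentC
      | by exists 1%N => //; left | by exists 1%N => //; right | by exists 1%N => //; left; rewrite segmentC
      | by exists 1%N => //; right; rewrite segmentC
      | by exists 2%N => //; left | by exists 2%N => //; right | by exists 2%N => //; left; rewrite segmentC
      | by exists 2%N => //; right; rewrite segmentC ].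
Qed.

Lemma boundary_outer : pinwheel_boundary u w =
  [set p | exists2 v, v \in hcycle i &
    segment (radial R b v) (radial R b (next (hcycle i) v)) p].
Proof.
have n2 : (i.+1 == i) = false by lia.
apply/seteqP; split => p.
  have wit c k : (c < 3)%N -> (k == i) || (k == i.+1) ->
      segment (radial R b (c, k)) (radial R b ((c + 2) %% 3, if k == i then i.+1 else i)%N) p ->
      exists2 v, v \in hcycle i & segment (radial R b v) (radial R b (next (hcycle i) v)) p.
    move=> c3 ki pP; have vC : (c, k) \in hcycle i by rewrite mem_hcycle /= c3.
    by exists (c, k); rewrite // next_hcycle.
  have := (fun c c3 => wit c i.+1 c3); rewrite eqxx orbT n2 => wit1.
  have := (fun c c3 => wit c i c3); rewrite eqxx => wit0.
  move: wit0 wit1 => {wit}; rewrite /cross_start /cross_end /e /radial /ray /=.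
  move: (exists2 v, _ & _) => goal.
  case: (odd i); case: b => /= wit0 wit1 -[r]; case: r => [|[|[|]]] // _ [] pP;
  first [ exact: (wit0 0%N isT isT) | exact: (wit0 1%N isT isT) | exact: (wit0 2%N isT isT)
        | exact: (wit1 0%N isT isT) | exact: (wit1 1%N isT isT) | exact: (wit1 2%N isT isT)
        | by move: pP; rewrite segmentC => pP;
          first [ exact: (wit0 0%N isT isT) | exact: (wit0 1%N isT isT) | exact: (wit0 2%N isT isT)
        | exact: (wit1 0%N isT isT) | exact: (wit1 1%N isT isT) | exact: (wit1 2%N isT isT) ] ].
have top c : (c < 3)%N ->
    segment (radial R b (c, i)) (radial R b ((c + 2) %% 3, i.+1)%N) `<=`
      pinwheel_boundary u w /\
    segment (radial R b (c, i.+1)) (radial R b ((c + 2) %% 3, i)%N) `<=`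
      pinwheel_boundary u w.
  move=> c3; have d3 : ((c + 2) %% 3 < 3)%N by rewrite ltn_mod.
  have inC d k : (d < 3)%N -> (k == i) || (k == i.+1) -> in_frakH i (d, k).
    by move=> ? ki; rewrite /in_frakH /=; apply/orP; right; lia.
  have ne : c != ((c + 2) %% 3)%N by case: c c3 {d3} => [|[|[|]]].
  split; last rewrite segmentC; apply: top_edge_boundary;
    by rewrite ?inC ?eqxx ?orbT // /up /= ?eqxx ?ne ?[_ == c]eq_sym ?ne ?orbT.
move=> [v vC]; rewrite next_hcycle //; move: vC; rewrite mem_hcycle.
case: v => c k /= /andP[/top[t0 t1] /orP[]/eqP->]; rewrite ?eqxx ?n2; first exact: t0.
exact: t1.
Qed.
End Boundary.

(** * Outer face and grid size of the radial drawing *)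

(** Allows columns and rows to be bounded without an exact count. *)
Lemma card_bounded_int (A : set int) (N : nat) : (forall c, A c -> `|c| <= N%:Z) ->
  exists W, A #= `I_W /\ (W <= 2 * N + 1)%N.
Proof.
move=> AN.
have leA : A #<= `I_(2 * N + 1).
  apply: (card_le_trans _ (card_image_le (fun k : nat => k%:Z - N%:Z) _)).
  apply: subset_card_le => c /AN cN; exists (absz (c + N%:Z)) => /=; lia.
have [W AW] : finite_set A by apply/finite_set_leP; exists (2 * N + 1)%N.
by exists W; split => //; rewrite -card_le_II; rewrite (card_le_eql AW) in leA.
Qed.

Section Frame.
Variable R : realType.
Variables (b : bool) (i : nat) (G : plane_graph (nat * nat)%type).
Hypothesis i1 : (1 <= i)%N.
Hypothesis VG : forall v, (v \in vertices G) = in_frakH i v.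
Hypothesis adjG : forall u v,
  adj G u v = [&& in_frakH i u, in_frakH i v & up u v || up v u].
Local Notation u := (cross_start R b i).
Local Notation w := (cross_end R b i).

Lemma cross_gt0 : 0 < u /\ 0 < w.
Proof. by rewrite /cross_start /cross_end !ltr0n; split; lia. Qed.

Lemma cross_neq : u != w.
Proof. by rewrite /cross_start /cross_end eqr_nat; case: (odd i (+) b); lia. Qed.

Lemma cross_sum : u + w = (2 * i + 1)%:R.
Proof. by rewrite /cross_start /cross_end -natrD; congr _%:R; case: (odd i (+) b); lia. Qed.

(** Edges between the two top levels lie on the boundary; all others stay at level at most i, the
    smaller of [u] and [w]. *)
Lemma up_edge_pinwheel x y : in_frakH i x -> in_frakH i y -> up x y ->
  segment (radial R b x) (radial R b y) `<=` pinwheel u w.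
Proof.
move=> xH yH xy; have [u0 w0] := cross_gt0.
have [xi|xi] := eqVneq x.2 i.
  move=> p /(top_edge_boundary i1 xH yH xy xi).
  by rewrite -pinwheel_boundaryE ?cross_neq // => -[].
have /andP[/eqP y2 _] := xy.
have {}xi : (x.2 < i)%N.
  by move: yH xi; rewrite /in_frakH => /orP[/eqP e|/and3P[]]; [rewrite e in y2|lia].
move=> _ [t /andP[t0 t1] ->].
rewrite !spokeM1 !spokeM2.
have le : (1 - t) * x.2%:R + t * y.2%:R <= i%:R.
  have : x.2%:R + 1 <= i%:R :> R by rewrite natr1 ler_nat.
  rewrite y2 -natr1; lra.
apply: comb_pinwheel => //; rewrite ?ray_lt3 // ?mulr_ge0 ?subr_ge0 //.
  by apply: (le_trans le); rewrite ler_nat leq_addl.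
by apply: (le_trans le); rewrite ler_nat leq_addl.
Qed.

Lemma drawing_pinwheel : drawing_points G (radial R b) `<=` pinwheel u w.
Proof.
have seg x y : adj G x y -> segment (radial R b x) (radial R b y) `<=` pinwheel u w.
  rewrite adjG => /and3P[xH yH /orP[xy|yx]]; first exact: up_edge_pinwheel.
  by rewrite segmentC; apply: up_edge_pinwheel.
move=> p [[v + ->]|[x [y [/seg]]]]; last exact.
rewrite VG => vH; have [v0|v0] := posnP v.2.
  have := @pinwheel0 _ _ _ cross_gt0.1 cross_gt0.2; congr (pinwheel _ _ _).
  by rewrite (in_frakH0 vH v0) /radial /spoke /=; do 2?case: ifP => // _; rewrite oppr0.
apply: (@up_edge_pinwheel (parent v) v) => //; first exact: in_frakH_parent.
  exact: up_parent vH _.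
by rewrite segmentC; apply: segment_l.
Qed.

Lemma boundary_drawing : pinwheel_boundary u w `<=` drawing_points G (radial R b).
Proof.
rewrite boundary_outer // => p [v vC pv]; right; exists v, (next (hcycle i) v); split => //.
move: vC (vC); rewrite {1}mem_hcycle => + vC; rewrite next_hcycle // adjG /in_frakH /up.
case: v vC {pv} => c k /= _ /andP[c3 ki].
have n2 : (i.+1 == i) = false by lia.
by case/orP: ki => /eqP->; rewrite ?eqxx ?n2;
  case: c c3 => [|[|[|]]] // _; rewrite /hx !xpair_eqE /=; lia.
Qed.

Lemma radial_outer_face :
  closure (outer_face G (radial R b)) `\` (outer_face G (radial R b))° =
  [set p | exists2 v, v \in hcycle i &
    segment (radial R b v) (radial R b (next (hcycle i) v)) p].
Proof.
have [u0 w0] := cross_gt0.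
have PQ := pinwheel_boundaryE u0 w0 cross_neq.
rewrite -boundary_outer // -PQ; apply: outer_face_boundary.
- exact: closed_pinwheel.
- exact: closed_pinwheel_out.
- exact: pinwheel_cover.
- exact: bounded_pinwheel.
- exact: pinwheel0.
- by move=> p t; apply: pinwheel_scale.
- exact: pinwheel_out_closure.
- exact: drawing_pinwheel.
- by rewrite PQ; apply: boundary_drawing.
Qed.

(** The pinwheel lies in the square of half-side u + w = 2 i + 1, which meets 4 i + 3 columns and as
    many rows. *)
Lemma radial_grid : exists W H : nat,
  [/\ lies_on_grid G (radial R b) W H, (W <= 4 * i + 3)%N & (H <= 4 * i + 3)%N].
Proof.
have [u0 w0] := cross_gt0.
have bd p : drawing_points G (radial R b) p ->
    `|p.1| <= (2 * i + 1)%:R /\ `|p.2| <= (2 * i + 1)%:R.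
  move/drawing_pinwheel/(pinwheel_norm u0 w0); rewrite cross_sum prod_normE ge_max.
  by case/andP.
have intR (c : int) : `|c%:~R| <= (2 * i + 1)%:R :> R -> `|c| <= (2 * i + 1)%:Z.
  by rewrite -intr_norm -[(2 * i + 1)%:R]/((2 * i + 1)%:Z%:~R) ler_int.
have [W [AW lW]] : exists W,
    [set c : int | exists2 p, drawing_points G (radial R b) p & p.1 = c%:~R] #= `I_W /\
    (W <= 2 * (2 * i + 1) + 1)%N.
  by apply: card_bounded_int => c [p /bd[p1 _] e]; apply: intR; rewrite -e.
have [H [AH lH]] : exists W,
    [set c : int | exists2 p, drawing_points G (radial R b) p & p.2 = c%:~R] #= `I_W /\
    (W <= 2 * (2 * i + 1) + 1)%N.
  by apply: card_bounded_int => c [p /bd[_ p2] e]; apply: intR; rewrite -e.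
exists W, H; split; [split => //| lia | lia].
by move=> v _; rewrite /radial /spoke; do 2?case: ifP => _ /=;
  rewrite ?rpredN ?rpred0 ?natr_int.
Qed.
End Frame.

(** * Mirror images and conclusion *)

(** Reversal exchanges [next] and [prev], so the side leaving [v] in [rev C] is the side entering
    [v] in [C]. *)
Lemma next_mirror (T : eqType) (C : seq T) (Pt : T -> T -> Prop) :
  uniq C -> (forall x y, Pt x y -> Pt y x) ->
  (exists2 v, v \in rev C & Pt v (next (rev C) v)) <-> (exists2 v, v \in C & Pt v (next C v)).
Proof.
move=> uC sP; split=> -[v]; rewrite ?mem_rev => vC.
  rewrite next_rev // => /sP h; exists (prev C v); first by rewrite mem_prev.
  by rewrite next_prev.
move=> /sP h; exists (next C v); first by rewrite mem_rev mem_next.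
by rewrite next_rev // prev_next.
Qed.

Theorem theorem1 (R : realType) :
  exists C : nat, forall (G : plane_graph (nat * nat)%type) (n : nat),
    familyH G -> #|` vertices G|%fset = n ->
    exists D : nat * nat -> (R * R)%type,
      [/\ planar_drawing G D,
          angle_monotone G D,
          respects_embedding G D
        & exists W H : nat,
            [/\ lies_on_grid G D W H, (W <= C * n)%N & (H <= C * n)%N]].
Proof.
(* The constant 2 suffices since 4 i + 3 <= 2 (3 i + 4). *)
exists 2%N => G n [i i1 GE] cardG.
(* The flag [b] exchanges the first two rays, which reflects the drawing in the diagonal and so
   treats the mirrored embedding. *)
have {GE} [b GE] : exists b : bool, G = if b then mirror (frakH i) else frakH i.
  by case: GE => ->; [exists false|exists true].
have VG v : (v \in vertices G) = in_frakH i v.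
  by rewrite GE -mem_frakH; case: (b).
have nG v : nbrs G v = if b then rev (frakH_nbrs i v) else frakH_nbrs i v.
  by rewrite GE -nbrs_frakH; case: (b).
have adjG x y : adj G x y = [&& in_frakH i x, in_frakH i y & up x y || up y x].
  by rewrite -adj_frakH /adj /= nG nbrs_frakH; case: (b); rewrite ?mem_rev.
have nE : n = (3 * i + 4)%N by rewrite -cardG GE -card_frakH; case: (b).
exists (radial R b); split.
- exact: radial_planar VG adjG.
- exact: radial_angle_monotone VG adjG.
- split; first exact: radial_circular_orders VG nG.
  have oG : outer G = if b then rev (hcycle i) else hcycle i.
    by rewrite GE; case: (i) i1 => // j _; case: (b).
  rewrite /same_outer_face (radial_outer_face _ _ i1 VG adjG) oG; case: ifP => // _.
  have sym b' p x y : segment (radial R b' x) (radial R b' y) p ->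
      segment (radial R b' y) (radial R b' x) p by rewrite segmentC.
  apply/seteqP; split => p.
    exact: (next_mirror (uniq_hcycle i) (sym true p)).2.
  exact: (next_mirror (uniq_hcycle i) (sym true p)).1.
- have [W [H [WH lW lH]]] := radial_grid R b i1 VG adjG.
  by exists W, H; split => //; rewrite nE; lia.
Qed.
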